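(* Let $p_0\in(0,1)$ and $m=1-p_0$. Consider the special branching random walk $X^s$ described in the context, in which at each step the particle makes a $\pm1$ jump with probability $1/2$ each and then produces no offspring with probability $p_0$ or exactly one offspring with probability $1-p_0$. Let $\rho=(1+\sqrt{1-m^2})/m$. Then for every $a>0$ with $a\neq 1/\sqrt{1-m^2}$, $$\lim_{n\to\infty}\rho^{\,n}\,P\big(M^s_{an}\ge n\big)=\begin{cases}0 & \text{if } a<1/\sqrt{1-m^2},\\ 1&\text{if } a>1/\sqrt{1-m^2}.\end{cases}$$
   Context: $X^s$ starts from a single particle at position $0$ (generation $0$). In each generation the current particle first jumps by $+1$ or $-1$ with probability $1/2$ each, and then, independently, produces one offspring (located at the position reached by the jump) with probability $1-p_0$, or no offspring with probability $p_0$ (in which case the process dies and the jump leaves no trace). For real $t\ge0$, $M^s_t$ denotes the maximal position of the particles of generations $\le t$. In particular, $P(M^s_t\ge n)=\sum_{j\le t}m^jP(\tau_n=j)$ for integers $n\ge1$, where $\tau_n$ is the first hitting time of $[n,\infty)$ by the simple symmetric random walk started at $0$. *)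

(* Defs.v *)
From HB Require Import structures.
From mathcomp Require Import all_boot all_order all_algebra.
From mathcomp Require Import all_classical all_reals all_analysis.

Set Implicit Arguments.
Unset Strict Implicit.
Unset Printing Implicit Defensive.

Import Order.TTheory GRing.Theory Num.Theory.
Import numFieldNormedType.Exports.

Local Open Scope classical_set_scope.
Local Open Scope ring_scope.

Definition mutually_independent d (T : measurableType d) (R : realType)
    (P : probability T R) (I : eqType) (F : I -> set (set T)) : Prop :=
  forall (J : seq I) (A : I -> set T), uniq J -> (forall i, F i (A i)) ->
    (P (\big[setI/setT]_(i <- J) A i) = \prod_(i <- J) P (A i))%E.

(* [jump k] and [offspring k] drive the passage from generation [k] to
   generation [k.+1]; if there is no particle left in generation [k], they are
   simply not used. *)
Record special_brw_noise d (T : measurableType d) (R : realType)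
    (P : probability T R) (p0 : R)
    (jump : nat -> {RV P >-> R}) (offspring : nat -> {RV P >-> nat}) : Prop :=
  SpecialBRWNoise {
    jump_up : forall k, P [set w | jump k w = 1] = (2^-1)%:E ;
    jump_down : forall k, P [set w | jump k w = -1] = (2^-1)%:E ;
    offspring_one : forall k, P [set w | offspring k w = 1%N] = (1 - p0)%:E ;
    offspring_none : forall k, P [set w | offspring k w = 0%N] = p0%:E ;
    noise_independent : mutually_independent P
      (fun i : nat + nat => match i with
        | inl k => g_sigma_algebra_preimage (jump k)
        | inr k => g_sigma_algebra_preimage (offspring k)
        end)
  }.

(* The position of the particle of generation [k], [None] if the process is
   extinct. A generation never has more than one particle: almost surely, the
   offspring numbers are 0 or 1. *)
Fixpoint brw_particle (T : Type) (R : realType) (jump : nat -> T -> R)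
    (offspring : nat -> T -> nat) (k : nat) (w : T) : option R :=
  if k is k'.+1 then
    if brw_particle jump offspring k' w is Some x then
      if offspring k' w == 0%N then None else Some (x + jump k' w)
    else None
  else Some 0.

(* The maximum of the positions of the particles of generations 0, ..., floor t.
   Starting the maximum at 0 is harmless for [0 <= t]: generation 0 consists of
   one particle at 0. *)
Definition brw_max (T : Type) (R : realType) (jump : nat -> T -> R)
    (offspring : nat -> T -> nat) (t : R) (w : T) : R :=
  \big[Num.max/0]_(x <- pmap (fun j => brw_particle jump offspring j w)
                             (iota 0 (Num.truncn t).+1)) x.

(* Main.v *)
(** The first step of the particle gives a recursion for the probability
  [q N k] that it climbs at least [k] within [N] generations:
  [q N.+1 k.+1 = m / 2 * (q N k + q N k.+2)].  With [s = sqrt (1 - m^2)], the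
  tilted quantity [u N k = rho^k * q N k] satisfies the same recursion with
  weights [(1 + s) / 2] and [(1 - s) / 2]: it is the probability that a walk with
  drift [s] reaches [k] by time [N], and the dichotomy at [a = 1 / s] is its law
  of large numbers.  Quantitatively, [y^k * L^N] dominates [u] (resp. [1 - u])
  for [y = 1 / (1 + e)], [L = 1 + s e + e^2] (resp. [y = 1 + e],
  [L = 1 - s e + e^2]), and for small [e] it decays exponentially along
  [N ~ a k] when [a s < 1] (resp. [a s > 1]). *)

Require Import Defs.
From HB Require Import structures.
From mathcomp Require Import all_boot all_order all_algebra.
From mathcomp Require Import all_classical all_reals all_analysis.
From mathcomp Require Import ring lra.

Set Implicit Arguments.
Unset Strict Implicit.
Unset Printing Implicit Defensive.

Import Order.TTheory GRing.Theory Num.Theory.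
Import numFieldNormedType.Exports.

Local Open Scope classical_set_scope.
Local Open Scope ring_scope.

(** * Level-reaching recursion, comparison principle and exponential bounds *)

(** For [k > 0] this is the sum over [j <= N] of [m^j] times the probability that a simple random
    walk first hits [k] at time [j]. *)
Fixpoint reach_prob (R : realType) (m : R) (N k : nat) : R :=
  match k, N with
  | 0%N, _ => 1
  | _.+1, 0%N => 0
  | k'.+1, N'.+1 => m / 2 * (reach_prob m N' k' + reach_prob m N' k'.+2)
  end.

Lemma reach_prob0 (R : realType) (m : R) N : reach_prob m N 0 = 1.
Proof. by case: N. Qed.

(** Comparison principle: nonnegative weights make the recursion monotone, and by [super] the
    product [y^k * L^N] can only lose when the recursion is applied to it. Domination on the
    boundary [k = 0] and at [N = 0] therefore propagates. *)
Lemma supersolution_bound (R : realType) (al be y L : R) (u : nat -> nat -> R) :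
  0 <= al -> 0 <= be -> 0 <= y -> 0 <= L -> al + be * y ^+ 2 <= L * y ->
  (forall N, u N 0%N <= L ^+ N) -> (forall k, u 0%N k.+1 <= y ^+ k.+1) ->
  (forall N k, u N.+1 k.+1 = al * u N k + be * u N k.+2) ->
  forall N k, u N k <= y ^+ k * L ^+ N.
Proof.
move=> al0 be0 y0 L0 super u0 ui ur; elim=> [|N IH] [|k].
- by rewrite expr0 mul1r.
- by rewrite expr0 mulr1.
- by rewrite expr0 mul1r.
rewrite ur; apply: (@le_trans _ _ ((al + be * y ^+ 2) * (y ^+ k * L ^+ N))).
  have -> : (al + be * y ^+ 2) * (y ^+ k * L ^+ N) =
    al * (y ^+ k * L ^+ N) + be * (y ^+ k.+2 * L ^+ N) by rewrite !exprS; ring.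
  by apply: lerD; apply: ler_wpM2l.
have -> : y ^+ k.+1 * L ^+ N.+1 = L * y * (y ^+ k * L ^+ N) by rewrite !exprS; ring.
by apply: ler_wpM2r => //; rewrite mulr_ge0 ?exprn_ge0.
Qed.

Lemma expr_le_expR (R : realType) (x : R) N :
  0 <= 1 + x -> (1 + x) ^+ N <= expR (N%:R * x).
Proof. by move=> x0; rewrite expRM_natl lerXn2r ?nnegrE ?expR_ge0 ?expR_ge1Dx. Qed.

Lemma cvg_expR_linear (R : realType) (c b : R) : c < 0 ->
  (fun n : nat => expR (n%:R * c + b)) @ \oo --> (0 : R).
Proof.
move=> c0.
have -> : (fun n : nat => expR (n%:R * c + b)) = (fun n => expR b * expR c ^+ n).
  by apply/funext => n; rewrite expRD expRM_natl mulrC.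
rewrite -[X in _ --> X](mulr0 (expR b)); apply: cvgMr.
by apply: cvg_expr; rewrite ger0_norm ?expR_ge0 // expR_lt1.
Qed.

(** With [1 + x <= expR x] and [N <= a * n], the supersolution turns into [expR (n * c)], where [c]
    is about [- e * (1 - a * s)] for small [e]. *)
Lemma biased_fast_cvg0 (R : realType) (s a : R) (u : nat -> nat -> R) :
  0 < s < 1 -> 0 < a ->
  (forall N k, u N.+1 k.+1 = (1 + s) / 2 * u N k + (1 - s) / 2 * u N k.+2) ->
  a * s < 1 ->
  (forall N k, 0 <= u N k) -> (forall N, u N 0%N = 1) -> (forall k, u 0%N k.+1 = 0) ->
  (fun n : nat => u (Num.truncn (a * n%:R)) n) @ \oo --> (0 : R).
Proof.
move=> /andP[s0 s1] a0 ur as1 uge0 u0 ui.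
(* This [e] gives [a * (s + e) < 1 - e], hence [a * (s + e) * (1 + e) < 1], which is what [c < 0]
   requires. *)
have [e [e0 eE]] : exists e : R, 0 < e /\ e * (1 + a) = (1 - a * s) / 2.
  exists ((1 - a * s) / (2 * (1 + a))); split; last by field; rewrite lt0r_neq0 //; lra.
  by rewrite divr_gt0 //; lra.
pose c : R := - (e / (1 + e)) + a * (s * e + e ^+ 2).
have c0 : c < 0.
  have -> : c = - (e / (1 + e)) * (1 - a * (s + e) * (1 + e)).
    by rewrite /c; field; rewrite lt0r_neq0 //; lra.
  rewrite mulNr oppr_lt0 mulr_gt0 ?divr_gt0 //; [lra|].
  have -> : a * (s + e) = 1 - (1 - a * s) / 2 - e by rewrite mulrDr; lra.
  nra.
have bound n : u (Num.truncn (a * n%:R)) n <= expR (n%:R * c + 0).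
  set N := Num.truncn _.
  have NE : N%:R <= a * n%:R by rewrite truncn_le // mulr_ge0 // ltW.
  apply: (@le_trans _ _ ((1 + e)^-1 ^+ n * (1 + (s * e + e ^+ 2)) ^+ N)).
    apply: (@supersolution_bound _ ((1 + s) / 2) ((1 - s) / 2)) => //.
    - lra.
    - lra.
    - by rewrite invr_ge0; lra.
    - nra.
    - rewrite -(ler_pM2r (_ : 0 < (1 + e) ^+ 2)); last by rewrite exprn_gt0; lra.
      have -> : ((1 + s) / 2 + (1 - s) / 2 * (1 + e)^-1 ^+ 2) * (1 + e) ^+ 2 =
        (1 + s) / 2 * (1 + e)^+2 + (1 - s) / 2 by field; rewrite lt0r_neq0 //; lra.
      have -> : (1 + (s * e + e ^+ 2)) / (1 + e) * (1 + e) ^+ 2 =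
        (1 + (s * e + e ^+ 2)) * (1 + e) by field; rewrite lt0r_neq0 //; lra.
      nra.
    - by move=> M; rewrite u0 exprn_ege1 //; nra.
    - by move=> k; rewrite ui exprn_ge0 // invr_ge0; lra.
  have -> : n%:R * c + 0 = n%:R * (- (e / (1 + e))) + a * n%:R * (s * e + e ^+ 2).
    by rewrite /c; ring.
  rewrite expRD; apply: ler_pM.
  - by rewrite exprn_ge0 // invr_ge0; lra.
  - by rewrite exprn_ge0 //; nra.
  - have inv1eE : (1 + e)^-1 = 1 + - (e / (1 + e)) by field; rewrite lt0r_neq0 //; lra.
    rewrite [X in X ^+ n]inv1eE; apply: expr_le_expR.
    by rewrite -inv1eE invr_ge0; lra.
  - apply: (le_trans (expr_le_expR _ _)); first nra.
    by rewrite ler_expR ler_wpM2r //; nra.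
apply: (@squeeze_cvgr _ _ _ _ (fun=> 0) (fun n : nat => expR (n%:R * c + 0))).
- by near=> n; rewrite uge0 bound.
- exact: cvg_cst.
- exact: cvg_expR_linear.
Unshelve. all: by end_near. Qed.

(** Meant for the probability of not having reached [k] by time [N], whence the exchanged boundary
    values. Growth of [y^k] is now beaten by decay of [L^N]. *)
Lemma biased_slow_cvg0 (R : realType) (s a : R) (u : nat -> nat -> R) :
  0 < s < 1 -> 0 < a ->
  (forall N k, u N.+1 k.+1 = (1 + s) / 2 * u N k + (1 - s) / 2 * u N k.+2) ->
  1 < a * s ->
  (forall N k, 0 <= u N k) -> (forall N, u N 0%N = 0) -> (forall k, u 0%N k.+1 = 1) ->
  (fun n : nat => u (Num.truncn (a * n%:R)) n) @ \oo --> (0 : R).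
Proof.
move=> /andP[s0 s1] a0 ur as1 uge0 u0 ui.
(* With this [e], [a * (s - e) = (a * s + 1) / 2 > 1], so [c < 0]. *)
have [e [e0 eE]] : exists e : R, 0 < e /\ e * a = (a * s - 1) / 2.
  exists ((a * s - 1) / (2 * a)); split; last by field; rewrite lt0r_neq0 //; lra.
  by rewrite divr_gt0 //; lra.
have es : e < s by nra.
pose c : R := e * (1 - a * (s - e)).
have c0 : c < 0 by rewrite /c pmulr_rlt0 //; nra.
have L0 : 0 <= 1 + (- (s * e) + e ^+ 2) by nra.
have bound n : u (Num.truncn (a * n%:R)) n <= expR (n%:R * c + e * (s - e)).
  set N := Num.truncn _.
  (* Since [L < 1], a lower bound on [N] is needed; the unit lost to truncation yields the constant
     [e * (s - e)] in the exponent. *)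
  have NE : a * n%:R - 1 <= N%:R.
    have := truncnS_gt (a * n%:R); rewrite -/N -natr1; lra.
  apply: (@le_trans _ _ ((1 + e) ^+ n * (1 + (- (s * e) + e ^+ 2)) ^+ N)).
    apply: (@supersolution_bound _ ((1 + s) / 2) ((1 - s) / 2)) => //.
    - lra.
    - lra.
    - lra.
    - nra.
    - by move=> M; rewrite u0 exprn_ge0.
    - by move=> k; rewrite ui exprn_ege1 //; lra.
  have -> : n%:R * c + e * (s - e) =
    n%:R * e + (a * n%:R - 1) * (- (s * e) + e ^+ 2) by rewrite /c; ring.
  rewrite expRD; apply: ler_pM.
  - by rewrite exprn_ge0 //; lra.
  - by rewrite exprn_ge0.
  - by apply: expr_le_expR; lra.
  - apply: (le_trans (expr_le_expR _ _)) => //.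
    by rewrite ler_expR ler_wnM2r //; nra.
apply: (@squeeze_cvgr _ _ _ _ (fun=> 0) (fun n : nat => expR (n%:R * c + e * (s - e)))).
- by near=> n; rewrite uge0 bound.
- exact: cvg_cst.
- exact: cvg_expR_linear.
Unshelve. all: by end_near. Qed.


(** * From the branching process to the recursion *)

Section special_brw.
Context (R : realType) (d : measure_display) (T : measurableType d)
  (P : probability T R) (p0 : R)
  (jump : nat -> {RV P >-> R}) (offspring : nat -> {RV P >-> nat}).
Hypothesis hX : special_brw_noise p0 jump offspring.
Implicit Types (b : seq bool) (y : R) (w : T).

Let particle := brw_particle (jump : nat -> T -> R) (offspring : nat -> T -> nat).

Lemma brw_particleS k w : particle k.+1 w =
  if particle k w is Some x then
    if offspring k w == 0%N then None else Some (x + jump k w)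
  else None.
Proof. by []. Qed.

Lemma brw_particleE k w : particle k w =
  if all (fun j => offspring j w != 0%N) (iota 0 k)
  then Some (\sum_(j <- iota 0 k) jump j w) else None.
Proof.
elim: k => [|k IH]; first by rewrite /= big_nil.
rewrite -[k.+1 in RHS]addn1 iotaD all_cat big_cat /= andbT big_seq1 add0n.
rewrite brw_particleS IH.
by case: all => //=; case: eqP.
Qed.

Lemma brw_particle_dead s j w : (s < j)%N -> offspring s w = 0%N -> particle j w = None.
Proof.
move=> sj os; rewrite brw_particleE ifF //; apply/negbTE/allPn.
by exists s; rewrite ?mem_iota ?os.
Qed.

(** The time window starts at an arbitrary generation [s], so that it can be shortened from the left
    as the history is revealed. *)
Definition hitting y s N : set T :=
  \bigcup_(j in [set j | (s <= j <= s + N)%N])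
    [set w | exists2 x, particle j w = Some x & y <= x].

Lemma measurable_hitting y s N : measurable (hitting y s N).
Proof.
apply: bigcup_measurable => j _.
have -> : [set w | exists2 x, particle j w = Some x & y <= x] =
    (\bigcap_(k in [set k | (k < j)%N]) (offspring k @^-1` [set~ 0%N])) `&`
    ((fun w => \sum_(k <- iota 0 j) jump k w) @^-1` `[y, +oo[).
  apply/seteqP; split=> w /=; rewrite brw_particleE; case: allP => H.
  - move=> [x [<-]] yx; split; last by rewrite in_itv /= andbT.
    by move=> k /= kj; apply/eqP/H; rewrite mem_iota.
  - by case.
  - by rewrite in_itv /= andbT => -[_ ?]; eexists.
  - case=> H' _; case: H => k; rewrite mem_iota => kj.
    by apply/eqP; apply: H'.
apply: measurableI.
  by apply: bigcap_measurableType => k _; apply: measurable_funPTI.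
by rewrite -[X in measurable X]setTI; apply: measurable_sum.
Qed.

Lemma brw_max_hitting n t :
  [set w | n%:R <= brw_max (jump : nat -> T -> R) (offspring : nat -> T -> nat) t w] =
  hitting n%:R 0 (Num.truncn t).
Proof.
set N := Num.truncn t.
apply/seteqP; split => w; rewrite /= /brw_max -/N -/particle.
  (* A positive level cannot be met by the default 0 of the maximum, so some particle attains it;
     level 0 is met by the initial particle. *)
  move=> H; have [n0|n0] := eqVneq n 0%N.
    by exists 0%N => //=; exists 0; rewrite ?n0.
  set r := pmap _ _ in H.
  have [x xr nx] : exists2 x, x \in r & n%:R <= x.
    apply: contrapT => Hn.
    have : \big[Num.max/0]_(x <- r) x < n%:R.
      rewrite big_seq; apply: bigmax_lt; first by rewrite ltr0n lt0n.
      by move=> x xr; rewrite ltNge; apply/negP => nx; apply: Hn; exists x.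
    by rewrite ltNge H.
  move: xr; rewrite mem_pmap => /mapP[j]; rewrite mem_iota add0n ltnS /= => jN Hj.
  by exists j => //; exists x.
move=> [j /= jN] [x Hj nx].
have xr : x \in pmap (particle^~ w) (iota 0 N.+1).
  by rewrite mem_pmap; apply/mapP; exists j; rewrite ?mem_iota.
exact: (@bigmax_sup_seq _ _ _ _ 0 x).
Qed.

Definition sgnb (c : bool) : R := if c then 1 else -1.

Definition cylinder b : set T :=
  [set w | forall k, (k < size b)%N ->
    jump k w = sgnb (nth true b k) /\ offspring k w = 1%N].

Lemma cylinder_rcons b c : cylinder (rcons b c) =
  cylinder b `&` [set w | jump (size b) w = sgnb c /\ offspring (size b) w = 1%N].
Proof.
apply/seteqP; split => w /=; rewrite /cylinder /= size_rcons.
  move=> H; split => [k kb|].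
    by have := H k (ltnW kb); rewrite nth_rcons kb.
  by have := H (size b) (ltnSn _); rewrite nth_rcons ltnn eqxx.
move=> [H1 H2] k; rewrite ltnS leq_eqVlt nth_rcons => /orP[/eqP ->|kb].
  by rewrite ltnn eqxx.
by rewrite kb; apply: H1.
Qed.

Lemma brw_particle_cylinder b w : cylinder b w ->
  particle (size b) w = Some (\sum_(c <- b) sgnb c).
Proof.
elim/last_ind: b => [|b c IH]; first by rewrite /= big_nil.
rewrite cylinder_rcons => -[wb /= [jc oc]].
by rewrite size_rcons brw_particleS IH // oc /= jc -cats1 big_cat big_seq1.
Qed.

(** This puts the cylinder in the form of [mutually_independent]: one event per jump and one per
    offspring number. *)
Lemma cylinder_bigcap b : cylinder b =
  \big[setI/setT]_(i <- map inl (iota 0 (size b)) ++ map inr (iota 0 (size b)))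
   (fun i : nat + nat => match i with
     | inl k => jump k @^-1` [set sgnb (nth true b k)]
     | inr k => offspring k @^-1` [set 1%N]
   end) i.
Proof.
rewrite -bigcap_seq; apply/seteqP; split => w /=.
  move=> H i /=; rewrite mem_cat => /orP[] /mapP[k]; rewrite mem_iota => kb -> /=;
  by have [] := H k kb.
move=> H k kb; split.
  by apply: (H (inl k)); rewrite /= mem_cat map_f ?mem_iota.
by apply: (H (inr k)); rewrite /= mem_cat [X in _ || X]map_f ?mem_iota ?orbT.
Qed.

Lemma measurable_cylinder b : measurable (cylinder b).
Proof.
rewrite cylinder_bigcap; apply: bigsetI_measurable => -[k|k] _;
  exact: measurable_funPTI.
Qed.

Lemma probability_cylinder b :
  P (cylinder b) = (((1 - p0) / 2) ^+ size b)%:E.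
Proof.
rewrite cylinder_bigcap (noise_independent hX).
- rewrite big_cat /= !big_map.
  rewrite (eq_bigr (fun=> (2^-1)%:E)); last first.
    by move=> k _; case: nth; [apply: (jump_up hX)|apply: (jump_down hX)].
  rewrite [X in (_ * X)%E](eq_bigr (fun=> (1 - p0)%:E)); last first.
    by move=> k _; apply: (offspring_one hX).
  rewrite !prodEFin -EFinM; congr EFin.
  by rewrite !big_const_seq !count_predT !size_iota !iter_mulr_1 exprMn mulrC.
- rewrite cat_uniq !map_inj_uniq ?iota_uniq /=; try by move=> ? ? [].
  by rewrite andbT; apply/hasPn => i /mapP[k _ ->]; apply/negP => /mapP[].
- by case=> k; (eexists; last by rewrite setTI).
Qed.

Lemma probabilityU (A B : set T) : measurable A -> measurable B ->
  A `&` B = set0 -> (P (A `|` B) = P A + P B)%E.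
Proof. exact: measureU. Qed.

Lemma probability_setI1 (A G : set T) : measurable A -> measurable G ->
  P G = 1%E -> P (A `&` G) = P A.
Proof.
move=> mA mG PG1; have -> : (P A = P (A `\` G) + P (A `&` G))%E by exact: measureDI.
rewrite (_ : P (A `\` G) = 0%E) ?add0e //; apply/eqP.
rewrite eq_le measure_ge0 andbT.
have PGC : P (~` G) = 0%E by rewrite probability_setC // PG1 subee.
rewrite -PGC; apply: le_measure; rewrite ?inE.
- exact: measurableD.
- exact: measurableC.
- by move=> w [].
Qed.

(** The noise takes its intended values only almost surely; this full-measure event makes the case
    split on one step exhaustive. *)
Definition legal s : set T :=
  ([set w | jump s w = 1] `|` [set w | jump s w = -1]) `&`
  ([set w | offspring s w = 1%N] `|` [set w | offspring s w = 0%N]).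

Lemma measurable_legal s : measurable (legal s).
Proof.
by apply: measurableI; apply: measurableU;
  rewrite -[[set _ | _]]/(_ @^-1` [set _]); apply: measurable_funPTI.
Qed.

Lemma probability_legal s : P (legal s) = 1%E.
Proof.
have mj (x : R) : measurable [set w | jump s w = x].
  by rewrite -[[set _ | _]]/(_ @^-1` [set _]); apply: measurable_funPTI.
have mo (x : nat) : measurable [set w | offspring s w = x].
  by rewrite -[[set _ | _]]/(_ @^-1` [set _]); apply: measurable_funPTI.
rewrite probability_setI1 ?probabilityU //; try exact: measurableU.
- rewrite (jump_up hX) (jump_down hX) -EFinD; congr EFin; lra.
- by apply/seteqP; split => w //= [-> ?]; lra.
- by rewrite (offspring_one hX) (offspring_none hX) -EFinD; congr EFin; lra.
- by apply/seteqP; split => w //= [-> ].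
Qed.

Lemma hittingS y s N w : ~ (exists2 x, particle s w = Some x & y <= x) ->
  hitting y s N.+1 w <-> hitting y s.+1 N w.
Proof.
move=> H; split=> -[j /= /andP[sj jN] hj].
  exists j => //=; rewrite addSnnS jN andbT ltn_neqAle sj andbT.
  by apply/eqP => sjE; apply: H; rewrite sjE.
by exists j => //=; rewrite (ltnW sj) -addSnnS.
Qed.

(** On the cylinder the particle sits strictly below [y], so the level must be reached later. This
    forces survival, and legality leaves only a jump up or down. *)
Lemma cylinder_hittingS b N y : \sum_(c <- b) sgnb c < y ->
  cylinder b `&` hitting y (size b) N.+1 `&` legal (size b) =
  (cylinder (rcons b true) `&` hitting y (size b).+1 N) `|`
  (cylinder (rcons b false) `&` hitting y (size b).+1 N).
Proof.
move=> by_lt; have nh w : cylinder b w ->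
    ~ (exists2 x, particle (size b) w = Some x & y <= x).
  by move=> /brw_particle_cylinder -> [x [<-]]; rewrite leNgt by_lt.
apply/seteqP; split => w.
- case=> -[wb]; rewrite hittingS; last exact: nh.
  move=> hw [wj wo]; rewrite !cylinder_rcons.
  have wo1 : offspring (size b) w = 1%N.
    case: wo => // /= wo0; case: hw => j /= /andP[bj _] [x].
    by rewrite (brw_particle_dead bj).
  by case: wj => /= wj; [left|right].
- rewrite !cylinder_rcons => -[] [[wb [wj wo]] hw];
    (split; first by split=> //; rewrite hittingS //; exact: nh).
    by split; left.
  by split; [right|left].
Qed.

(* Intersecting with a cylinder makes the induction on [N] self-contained: the
   two continuations of a cylinder are again cylinders, so only the product
   formula for point events is needed, no independence of generated
   sigma-algebras. *)
Lemma probability_cylinder_hitting N b k y : \sum_(c <- b) sgnb c + k%:R = y ->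
  P (cylinder b `&` hitting y (size b) N) =
  (((1 - p0) / 2) ^+ size b * reach_prob (1 - p0) N k)%:E.
Proof.
elim: N b k y => [|N IH] b [|k] y <-.
- rewrite addr0 reach_prob0 mulr1 -probability_cylinder; congr (P _).
  apply/setIidPl => w wb; exists (size b); rewrite /= ?leqnn ?leq_addr //.
  by exists (\sum_(c <- b) sgnb c) => //; apply: brw_particle_cylinder.
- rewrite mulr0 (_ : _ `&` _ = set0) ?measure0 //.
  apply/seteqP; split => w //= -[/brw_particle_cylinder wb] [j /=].
  rewrite addn0 -eqn_leq => /eqP <- [x]; rewrite wb => -[<-].
  by rewrite gerDl lern0.
- rewrite addr0 reach_prob0 mulr1 -probability_cylinder; congr (P _).
  apply/setIidPl => w wb; exists (size b); rewrite /= ?leqnn ?leq_addr //.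
  by exists (\sum_(c <- b) sgnb c) => //; apply: brw_particle_cylinder.
have mch b' s : measurable (cylinder b' `&` hitting (\sum_(c <- b) sgnb c + k.+1%:R) s N).
  by apply: measurableI; [exact: measurable_cylinder|exact: measurable_hitting].
(* Intersecting with the almost sure event [legal] allows the decomposition by the next jump. *)
rewrite -(@probability_setI1 _ (legal (size b))); last 3 first.
- by apply: measurableI; [exact: measurable_cylinder|exact: measurable_hitting].
- exact: measurable_legal.
- exact: probability_legal.
rewrite cylinder_hittingS; last by rewrite ltrDl ltr0n.
rewrite probabilityU //; last first.
  apply/seteqP; split => w //=; rewrite !cylinder_rcons.
  move=> -[[[_ /= [-> _]] _] [[_ /= [H _]] _]].
  by move: H; rewrite /sgnb => ?; lra.
(* The target is fixed while the endpoint moves: [k] levels remain after an up jump and [k.+2] after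
   a down jump. *)
have IHc c k' : sgnb c + k'%:R = k.+1%:R ->
    P (cylinder (rcons b c) `&` hitting (\sum_(c <- b) sgnb c + k.+1%:R) (size b).+1 N) =
    (((1 - p0) / 2) ^+ (size b).+1 * reach_prob (1 - p0) N k')%:E.
  move=> ck; have := IH (rcons b c) k' (\sum_(c <- b) sgnb c + k.+1%:R).
  rewrite size_rcons; apply.
  by rewrite -cats1 big_cat big_seq1 -addrA ck.
rewrite [X in (X + _)%E](IHc true k) ?[X in (_ + X)%E](IHc false k.+2) /=; last 2 first.
- by rewrite /sgnb -[k.+2]add1n natrD addKr.
- by rewrite /sgnb -[k.+1]add1n natrD.
by rewrite -EFinD -mulrDr exprSr -!mulrA.
Qed.

Lemma probability_brw_max n t :
  P [set w | n%:R <= brw_max (jump : nat -> T -> R) (offspring : nat -> T -> nat) t w] =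
  (reach_prob (1 - p0) (Num.truncn t) n)%:E.
Proof.
rewrite brw_max_hitting.
have := @probability_cylinder_hitting (Num.truncn t) [::] n n%:R.
rewrite big_nil add0r expr0 mul1r => <- //.
by rewrite (_ : cylinder [::] = setT) ?setTI //; apply/seteqP.
Qed.

End special_brw.

(** * Tilting and the dichotomy *)

Lemma reach_prob_ge0 (R : realType) (m : R) N k : 0 <= m -> 0 <= reach_prob m N k.
Proof.
move=> m0; elim: N k => [|N IH] [|k] //=.
by rewrite mulr_ge0 ?addr_ge0 ?divr_ge0.
Qed.

(* [m / 2 * rho] and [m / 2 / rho] are [(1 + s) / 2] and [(1 - s) / 2]: they sum
   to 1, so the tilted recursion is that of a walk with drift [s]. *)
Lemma tilted_reach_probS (R : realType) (m s : R) N k : m != 0 -> s ^+ 2 = 1 - m ^+ 2 ->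
  ((1 + s) / m) ^+ k.+1 * reach_prob m N.+1 k.+1 =
  (1 + s) / 2 * (((1 + s) / m) ^+ k * reach_prob m N k) +
  (1 - s) / 2 * (((1 + s) / m) ^+ k.+2 * reach_prob m N k.+2).
Proof.
move=> m0 sE; rewrite [reach_prob m N.+1 k.+1]/= !exprS.
have up : (1 + s) / m * (m / 2) = (1 + s) / 2 by field.
have down : (1 - s) / 2 * ((1 + s) / m) = m / 2.
  have -> : (1 - s) / 2 * ((1 + s) / m) = (1 - s ^+ 2) / (2 * m) by field.
  by rewrite sE; field.
rewrite mulrDr mulrDr; congr (_ + _); first by rewrite -up; ring.
by rewrite [RHS]mulrA [X in _ = X * _]mulrA down; ring.
Qed.

Theorem mainTheorem4 (R : realType) (d : measure_display) (T : measurableType d)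
    (P : probability T R) (p0 : R)
    (jump : nat -> {RV P >-> R}) (offspring : nat -> {RV P >-> nat})
    (hp0 : 0 < p0 < 1) (hX : special_brw_noise p0 jump offspring)
    (a : R) (ha : 0 < a) :
  let m := 1 - p0 in
  let rho := (1 + Num.sqrt (1 - m ^+ 2)) / m in
  let ac := 1 / Num.sqrt (1 - m ^+ 2) in
  let M := brw_max jump offspring in
  a != ac ->
  (fun n : nat => rho ^+ n * fine (P [set w | n%:R <= M (a * n%:R) w]))
    @ \oo --> (if a < ac then 0 else 1 : R).
Proof.
move=> m rho ac M aac.
have m01 : 0 < m < 1 by rewrite /m; lra.
case/andP: (m01) => m0 m1.
have sE : Num.sqrt (1 - m ^+ 2) ^+ 2 = 1 - m ^+ 2 by rewrite sqr_sqrtr //; nra.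
have s0 : 0 < Num.sqrt (1 - m ^+ 2) by rewrite sqrtr_gt0; nra.
move: @rho @ac aac sE s0; set s := Num.sqrt _ => rho ac aac sE s0.
have s1 : s < 1 by rewrite -(@ltr_pXn2r _ 2) ?nnegrE ?ltW // sE expr1n; nra.
have s01 : 0 < s < 1 by rewrite s0.
pose u N k := rho ^+ k * reach_prob m N k.
have -> : (fun n : nat => rho ^+ n * fine (P [set w | n%:R <= M (a * n%:R) w])) =
    (fun n : nat => u (Num.truncn (a * n%:R)) n).
  by apply/funext => n; rewrite (probability_brw_max hX).
have ur N k : u N.+1 k.+1 = (1 + s) / 2 * u N k + (1 - s) / 2 * u N k.+2.
  by apply: tilted_reach_probS => //; rewrite lt0r_neq0.
have u0 N : u N 0%N = 1 by rewrite /u expr0 reach_prob0 mulr1.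
have ui k : u 0%N k.+1 = 0 by rewrite /u mulr0.
have uge0 N k : 0 <= u N k.
  have rho0 : 0 < rho by apply: divr_gt0 => //; apply: addr_gt0.
  by apply: mulr_ge0; [exact: exprn_ge0 (ltW rho0)|exact: reach_prob_ge0 (ltW m0)].
(* The constant 1 is a supersolution: [y = L = 1], as the weights sum to 1. *)
have ule1 N k : u N k <= 1.
  have -> : 1 = (1 : R) ^+ k * 1 ^+ N by rewrite !expr1n mulr1.
  apply: (@supersolution_bound _ ((1 + s) / 2) ((1 - s) / 2)) => // [||||k'].
  - lra.
  - lra.
  - by rewrite expr1n; lra.
  - by move=> N'; rewrite u0 expr1n.
  - by rewrite ui expr1n.
case: ifP => aac'.
  by apply: (biased_fast_cvg0 s01 ha ur) => //; rewrite -ltr_pdivlMr.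
have as1 : 1 < a * s by rewrite -ltr_pdivrMr // lt_neqAle eq_sym aac leNgt aac'.
(* Because the weights sum to 1, [1 - u] obeys the same recursion, with the boundary values
   swapped. *)
have v0 : (fun n : nat => 1 - u (Num.truncn (a * n%:R)) n) @ \oo --> (0 : R).
  apply: (@biased_slow_cvg0 _ s a (fun N k => 1 - u N k)) => //.
  - by move=> N k; rewrite ur; lra.
  - by move=> N k; rewrite subr_ge0.
  - by move=> N; rewrite u0 subrr.
  - by move=> k; rewrite ui subr0.
rewrite (_ : (fun n : nat => _) = (fun n => 1 - (1 - u (Num.truncn (a * n%:R)) n))).
  by rewrite -[X in _ --> X]subr0; apply: cvgB; [exact: cvg_cst|exact: v0].
by apply/funext => n; rewrite opprB addrC subrK.
Qed.
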